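(* There is an embedding of the dual of the Boolean algebra $\mathcal{P}(2^\omega)$ into the Medvedev lattice as an upper semilattice; that is, there is an injective map $F$ from $\mathcal{P}(2^\omega)$ to the Medvedev degrees such that $I\subseteq J$ if and only if $F(J)\leq_M F(I)$, and $F(I\cap J)=F(I)+F(J)$ (the join in the Medvedev lattice) for all $I,J\subseteq2^\omega$.
   Context: A mass problem is a subset of $\omega^\omega$. $\mathcal{A}\leq_M\mathcal{B}$ means there is a partial computable functional $\Psi$ defined on all of $\mathcal{B}$ with $\Psi(\mathcal{B})\subseteq\mathcal{A}$; Medvedev degrees are the $\equiv_M$-classes of mass problems with the induced order. The join is induced by $\mathcal{A}+\mathcal{B}=\{f\oplus g:f\in\mathcal{A},g\in\mathcal{B}\}$, where $(f\oplus g)(2x)=f(x)$, $(f\oplus g)(2x+1)=g(x)$. The dual of $\mathcal{P}(2^\omega)$ is the power set of $2^\omega$ ordered by reverse inclusion, so its join is intersection. *)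

(* Defs.v *)
From HB Require Import structures.
From mathcomp Require Import all_boot all_order generic_quotient.
From mathcomp Require Import boolp classical_sets.

Set Implicit Arguments.
Unset Strict Implicit.
Unset Printing Implicit Defensive.

Import Order.TTheory.

(* Programs for the partial functions on nat that are computable relative to a
   function oracle: Kleene's schemes (zero, successor, projections,
   composition, primitive recursion, minimization) plus a call to the oracle.
   The index is the arity. *)
Inductive code : nat -> Type :=
| Zero n : code n
| Succ : code 1
| Proj n (i : 'I_n) : code n
| Oracle : code 1
| Comp m n (c : code m) (ds : 'I_m -> code n) : code n
| Rec n (c : code n) (d : code n.+2) : code n.+1
| Mu n (c : code n.+1) : code n.

Fixpoint prim_rec (base : nat -> Prop) (step : nat -> nat -> nat -> Prop)
    (k y : nat) : Prop :=
  if k is k'.+1 then exists2 z, prim_rec base step k' z & step k' z y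
  else base y.

(* [eval f c xs y] : the program c with oracle f halts on input xs with
   output y.  Composition is strict, and the recursion variable of [Rec] and
   the search variable of [Mu] are the first argument. *)
Fixpoint eval (f : nat -> nat) n (c : code n) : n.-tuple nat -> nat -> Prop :=
  match c in code n return n.-tuple nat -> nat -> Prop with
  | Zero _ => fun _ y => y = 0
  | Succ => fun xs y => y = (thead xs).+1
  | Proj _ i => fun xs y => y = tnth xs i
  | Oracle => fun xs y => y = f (thead xs)
  | Comp m _ c ds => fun xs y =>
      exists2 ys : m.-tuple nat,
        forall i, eval f (ds i) xs (tnth ys i) & eval f c ys y
  | Rec _ c d => fun xs y =>
      prim_rec (eval f c [tuple of behead xs])
        (fun k z => eval f d [tuple of [:: k, z & behead xs]])
        (thead xs) y
  | Mu _ c => fun xs y =>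
      eval f c [tuple of y :: xs] 0 /\
      forall z, z < y -> exists k, eval f c [tuple of z :: xs] k.+1
  end.

Lemma eval_inj f n (c : code n) xs y y' :
  eval f c xs y -> eval f c xs y' -> y = y'.
Proof.
elim: c xs y y' => {n} [n|| n i || m n c IHc ds IHd | n c IHc d IHd | n c IHc]
  xs y y' /=; try by move=> -> ->.
- move=> [ys Hys Hy] [zs Hzs Hz].
  have E : ys = zs by apply: eq_from_tnth => i; apply: IHd (Hys i) (Hzs i).
  by subst zs; apply: IHc Hy Hz.
- elim: (thead xs) y y' => [|k IHk] y y' /=; first exact: IHc.
  by move=> [z /IHk Hz Hy] [z' /Hz E Hy']; subst z'; apply: IHd Hy Hy'.
- move=> [Hy Ly] [Hy' Ly']; case: (ltngtP y y') => // lt.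
  + by have [k /(IHc _ _ _ Hy)] := Ly' _ lt.
  + by have [k /(IHc _ _ _ Hy')] := Ly _ lt.
Qed.

(* The partial computable functional with program e maps f to g; it is
   undefined at f when \x. e^f(x) is not total. *)
Definition functional (e : code 1) (f g : nat -> nat) : Prop :=
  forall x, eval f e [tuple x] (g x).

Lemma functional_inj e f g g' : functional e f g -> functional e f g' -> g = g'.
Proof. by move=> H H'; apply/funext => x; apply: eval_inj (H x) (H' x). Qed.

Definition mass_problem := set (nat -> nat).
HB.instance Definition _ := Choice.on mass_problem.

Definition medvedev_le (A B : mass_problem) : Prop :=
  exists e : code 1,
    (forall f, B f -> exists g, functional e f g) /\
    (forall f g, B f -> functional e f g -> A g).

Definition medvedev_equiv (A B : mass_problem) : Prop :=
  medvedev_le A B /\ medvedev_le B A.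

Definition oplus (f g : nat -> nat) (x : nat) : nat :=
  if odd x then g x./2 else f x./2.

Lemma oplus_even f g x : oplus f g (2 * x) = f x.
Proof. by rewrite /oplus mul2n odd_double doubleK. Qed.

Lemma oplus_odd f g x : oplus f g (2 * x + 1) = g x.
Proof. by rewrite /oplus mul2n addn1 oddS odd_double /= uphalf_double. Qed.

Definition mass_sum (A B : mass_problem) : mass_problem :=
  [set h | exists f g, [/\ A f, B g & h = oplus f g]]%classic.

Lemma medvedev_leP A B : medvedev_le A B <->
  exists e, forall f, B f -> exists2 g, A g & functional e f g.
Proof.
split=> [[e [H1 H2]]|[e H]]; exists e.
  by move=> f Bf; have [g Hg] := H1 f Bf; exists g => //; apply: H2 Hg.
split=> [f /H [g _ ?]|f g /H [g' Ag' Hg'] Hg]; first by exists g.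
by rewrite (functional_inj Hg Hg').
Qed.

Fixpoint oracle_subst (e : code 1) n (c : code n) : code n :=
  match c in code n return code n with
  | Zero n => Zero n
  | Succ => Succ
  | Proj _ i => Proj i
  | Oracle => e
  | Comp _ _ c ds => Comp (oracle_subst e c) (fun i => oracle_subst e (ds i))
  | Rec _ c d => Rec (oracle_subst e c) (oracle_subst e d)
  | Mu _ c => Mu (oracle_subst e c)
  end.

Lemma eval_oracle_subst e f g n (c : code n) xs y :
  functional e f g -> eval g c xs y -> eval f (oracle_subst e c) xs y.
Proof.
move=> Hg; elim: c xs y => {n} [n|| n i || m n c IHc ds IHd | n c IHc d IHd
  | n c IHc] xs y //=.
- by case/tupleP: xs => x xs ->; rewrite theadE (tuple0 xs); apply: Hg.
- by move=> [ys Hys Hy]; exists ys => [i|]; [apply: IHd | apply: IHc].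
- elim: (thead xs) y => [|k IHk] y /=; first exact: IHc.
  by move=> [z /IHk Hz Hy]; exists z => //; apply: IHd.
- move=> [Hy Ly]; split=> [|z /Ly [k Hk]]; first exact: IHc.
  by exists k; apply: IHc.
Qed.

Lemma medvedev_le_refl A : medvedev_le A A.
Proof. by apply/medvedev_leP; exists Oracle => f Af; exists f. Qed.

Lemma medvedev_le_trans B A C :
  medvedev_le A B -> medvedev_le B C -> medvedev_le A C.
Proof.
move=> /medvedev_leP [e He] /medvedev_leP [d Hd]; apply/medvedev_leP.
exists (oracle_subst d e) => f /Hd [g /He [h Ah Hh] Hg].
by exists h => // x; apply: eval_oracle_subst Hg (Hh x).
Qed.

Definition Comp1 n (c : code 1) (d : code n) : code n := Comp c (fun=> d).

Definition Comp3 n (c : code 3) (d1 d2 d3 : code n) : code n :=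
  Comp c (tnth [tuple d1; d2; d3]).

Lemma eval_Comp1 f n c (d : code n) xs x y :
  eval f d xs x -> eval f c [tuple x] y -> eval f (Comp1 c d) xs y.
Proof. by move=> Hx Hy; exists [tuple x] => // i; rewrite ord1. Qed.

Lemma eval_Comp3 f n c (d1 d2 d3 : code n) xs x1 x2 x3 y :
  eval f d1 xs x1 -> eval f d2 xs x2 -> eval f d3 xs x3 ->
  eval f c [tuple x1; x2; x3] y -> eval f (Comp3 c d1 d2 d3) xs y.
Proof.
move=> H1 H2 H3 Hy; exists [tuple x1; x2; x3] => // i.
by case: i => -[|[|[|//]]] lti; rewrite !(tnth_nth 0) (tnth_nth (Zero n)).
Qed.

Lemma prim_rec_sub (b b' : nat -> Prop) (s s' : nat -> nat -> nat -> Prop) k y :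
  (forall z, b z -> b' z) -> (forall i z w, s i z w -> s' i z w) ->
  prim_rec b s k y -> prim_rec b' s' k y.
Proof.
move=> sub_b sub_s; elim: k y => [|k IHk] y /=; first exact: sub_b.
by move=> [z /IHk Hz /sub_s Hy]; exists z.
Qed.

Lemma eval_Rec1 f (c : code 0) (d : code 2) x y :
  prim_rec (eval f c [tuple]) (fun k z => eval f d [tuple k; z]) x y ->
  eval f (Rec c d) [tuple x] y.
Proof.
have eval_val n (b : code n) (xs ys : n.-tuple nat) z :
    val xs = val ys -> eval f b xs z -> eval f b ys z by move/val_inj ->.
by apply: prim_rec_sub => [z|k z w]; apply: eval_val.
Qed.

Definition Cond : code 3 := Rec (Proj (inord 0)) (Proj (inord 3)).

Lemma eval_Cond f (b : bool) x y :
  eval f Cond [tuple (b : nat); x; y] (if b then y else x).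
Proof.
case: b => /=; last by rewrite (tnth_nth 0) inordK.
by exists x; rewrite (tnth_nth 0) inordK.
Qed.

Definition Not : code 1 := Rec (Comp1 Succ (Zero 0)) (Zero 2).

Lemma eval_Not f (b : bool) : eval f Not [tuple (b : nat)] (~~ b).
Proof.
have H : eval f (Comp1 Succ (Zero 0)) [tuple] 1.
  exact: (@eval_Comp1 _ _ _ _ _ 0).
by case: b; [exists 1 | exact: H].
Qed.

Definition Odd : code 1 := Rec (Zero 0) (Comp1 Not (Proj (inord 1))).

Lemma eval_Odd f x : eval f Odd [tuple x] (odd x).
Proof.
apply: eval_Rec1; elim: x => [//|x IHx].
exists (odd x : nat) => //.
by apply: eval_Comp1 (eval_Not f (odd x)); rewrite /= (tnth_nth 0) inordK.
Qed.

Definition Half : code 1 :=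
  Rec (Zero 0) (Comp3 Cond (Comp1 Odd (Proj (inord 0))) (Proj (inord 1))
                 (Comp1 Succ (Proj (inord 1)))).

Lemma eval_Half f x : eval f Half [tuple x] x./2.
Proof.
apply: eval_Rec1; elim: x => [//|x IHx].
exists x./2 => //.
have -> : x.+1./2 = if odd x then x./2.+1 else x./2.
  by rewrite -uphalfE uphalf_half; case: (odd x).
apply: eval_Comp3 (eval_Cond f (odd x) _ _).
- by apply: eval_Comp1 (eval_Odd f x); rewrite /= (tnth_nth 0) inordK.
- by rewrite /= (tnth_nth 0) inordK.
- by apply: (@eval_Comp1 _ _ _ _ _ x./2) => //=; rewrite (tnth_nth 0) inordK.
Qed.

Definition Double : code 1 :=
  Rec (Zero 0) (Comp1 Succ (Comp1 Succ (Proj (inord 1)))).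

Lemma eval_Double f x : eval f Double [tuple x] x.*2.
Proof.
apply: eval_Rec1; elim: x => [//|x IHx].
exists x.*2 => //; apply: (@eval_Comp1 _ _ _ _ _ x.*2.+1) => //.
by apply: (@eval_Comp1 _ _ _ _ _ x.*2) => //=; rewrite (tnth_nth 0) inordK.
Qed.

Lemma mass_sum_ub1 A B : medvedev_le A (mass_sum A B).
Proof.
apply/medvedev_leP; exists (Comp1 Oracle Double) => h [f [g [Af _ ->]]].
exists f => // x; apply: eval_Comp1 (eval_Double _ x) _ => /=.
by rewrite -muln2 mulnC oplus_even.
Qed.

Lemma mass_sum_ub2 A B : medvedev_le B (mass_sum A B).
Proof.
apply/medvedev_leP.
exists (Comp1 Oracle (Comp1 Succ Double)) => h [f [g [_ Bg ->]]].
exists g => // x; apply: (@eval_Comp1 _ _ _ _ _ x.*2.+1).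
  by apply: eval_Comp1 (eval_Double _ x) _.
by rewrite /= theadE -addn1 -mul2n oplus_odd.
Qed.

Lemma mass_sum_lub A B C :
  medvedev_le A C -> medvedev_le B C -> medvedev_le (mass_sum A B) C.
Proof.
move=> /medvedev_leP [d Hd] /medvedev_leP [e He]; apply/medvedev_leP.
exists (Comp3 Cond Odd (Comp1 d Half) (Comp1 e Half)) => h Ch.
have [[f Af Hf] [g Bg Hg]] := (Hd h Ch, He h Ch).
exists (oplus f g); first by exists f, g.
move=> x; apply: eval_Comp3 (eval_Cond h (odd x) _ _).
- exact: eval_Odd.
- exact: eval_Comp1 (eval_Half h x) (Hf _).
- exact: eval_Comp1 (eval_Half h x) (Hg _).
Qed.

Definition medvedev_eqb : rel mass_problem :=
  fun A B => `[< medvedev_equiv A B >].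

Lemma medvedev_eqb_refl : reflexive medvedev_eqb.
Proof. by move=> A; apply/asboolP; split; apply: medvedev_le_refl. Qed.

Lemma medvedev_eqb_sym : symmetric medvedev_eqb.
Proof. by move=> A B; apply: asbool_equiv_eq; split; case. Qed.

Lemma medvedev_eqb_trans : transitive medvedev_eqb.
Proof.
move=> B A C /asboolP [AB BA] /asboolP [BC CB]; apply/asboolP.
by split; apply: (@medvedev_le_trans B).
Qed.

Canonical medvedev_eqb_equiv :=
  EquivRel medvedev_eqb medvedev_eqb_refl medvedev_eqb_sym medvedev_eqb_trans.

Definition medvedev := {eq_quot medvedev_eqb}%qT.
HB.instance Definition _ := Choice.on medvedev.
HB.instance Definition _ := Quotient.on medvedev.
HB.instance Definition _ := EqQuotient.on medvedev.

Definition degree (A : mass_problem) : medvedev := \pi_medvedev%qT A.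

Lemma degree_eq A B : degree A = degree B <-> medvedev_equiv A B.
Proof. by split=> [/eqmodP/asboolP|H]; last exact/eqmodP/asboolP. Qed.

Lemma degree_repr (D : medvedev) : degree (repr D) = D.
Proof. exact: reprK. Qed.

Lemma repr_degree A : medvedev_equiv (repr (degree A)) A.
Proof. by apply/degree_eq; rewrite degree_repr. Qed.

(* The order and the join induced on degrees; [degree_le] and [degree_join]
   state their independence of the representatives chosen by [repr]. *)
Definition medvedev_deg_le : rel medvedev :=
  fun D E => `[< medvedev_le (repr D) (repr E) >].

Definition medvedev_deg_join (D E : medvedev) : medvedev :=
  degree (mass_sum (repr D) (repr E)).

Lemma medvedev_deg_le_refl : reflexive medvedev_deg_le.
Proof. by move=> D; apply/asboolP/medvedev_le_refl. Qed.

Lemma medvedev_deg_le_anti : antisymmetric medvedev_deg_le.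
Proof.
move=> D E /andP [/asboolP DE /asboolP ED].
by rewrite -(degree_repr D) -(degree_repr E); apply/degree_eq.
Qed.

Lemma medvedev_deg_le_trans : transitive medvedev_deg_le.
Proof.
move=> E D G /asboolP DE /asboolP EG.
exact/asboolP/(medvedev_le_trans DE EG).
Qed.

Fact medvedev_display : Order.disp_t. Proof. exact: Order.Disp tt tt. Qed.

HB.instance Definition _ := Order.Le_isPOrder.Build medvedev_display medvedev
  medvedev_deg_le_refl medvedev_deg_le_anti medvedev_deg_le_trans.

Lemma degree_le A B : (degree A <= degree B)%O <-> medvedev_le A B.
Proof.
have [[rA Ar] [rB Br]] := (repr_degree A, repr_degree B).
split=> [/asboolP H|H].
  exact: medvedev_le_trans Ar (medvedev_le_trans H rB).
exact/asboolP/(medvedev_le_trans rA)/(medvedev_le_trans H).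
Qed.

Lemma medvedev_deg_joinP (D E G : medvedev) :
  (medvedev_deg_join D E <= G)%O = (D <= G)%O && (E <= G)%O.
Proof.
rewrite -(degree_repr G) -{2}(degree_repr D) -{2}(degree_repr E).
apply/idP/andP => [/degree_le H|[/degree_le DG /degree_le EG]].
  by split; apply/degree_le; apply: medvedev_le_trans H;
    [apply: mass_sum_ub1 | apply: mass_sum_ub2].
exact/degree_le/mass_sum_lub.
Qed.

HB.instance Definition _ := Order.POrder_isJoinSemilattice.Build
  medvedev_display medvedev medvedev_deg_joinP.

Lemma degree_join A B :
  (degree A `|` degree B)%O = degree (mass_sum A B).
Proof.
apply: le_anti; rewrite leUx -(degree_repr (degree A `|` degree B)%O).
apply/andP; split; first apply/andP; first split.
- exact/degree_le/mass_sum_ub1.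
- exact/degree_le/mass_sum_ub2.
- by apply/degree_le; apply: mass_sum_lub; apply/degree_le;
    rewrite degree_repr ?leUl ?leUr.
Qed.

(* Main.v *)
Require Import Defs.
From mathcomp Require Import all_boot all_order.
From mathcomp Require Import boolp classical_sets.

(** Fix a family [F_alpha], for [alpha] in Cantor space, of pairwise Turing
    incomparable functions, and send [I] to the degree of the set of those [h]
    that compute some [F_alpha] with [alpha] in [I], or that compute two
    different members of the family.  Since [F_alpha] itself computes only one
    member, the order is reflected.  If [f] computes [F_alpha] and [g] computes
    [F_beta], then [f (+) g] computes both, so it solves the problem of
    [I `&` J] either because [alpha = beta] or because it computes two members;
    the disjunction is never decided, and the reduction is the identity.

    The family is the set of branches of a perfect tree of finite conditions:
    at level [s], the first [s] programs are diagonalized against for every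
    pair of distinct nodes. *)

Set Implicit Arguments.
Unset Strict Implicit.
Unset Printing Implicit Defensive.

(** * Continuity and enumerability of programs *)

Definition agree (n : nat) (f g : nat -> nat) := forall x, x < n -> f x = g x.

Lemma agree_trans n f g h : agree n f g -> agree n g h -> agree n f h.
Proof. by move=> fg gh x ltx; rewrite fg ?gh. Qed.

Lemma agree_le m n f g : m <= n -> agree n f g -> agree m f g.
Proof. by move=> lemn fg x ltx; apply/fg/(leq_trans ltx). Qed.

(** Takes the maximum of finitely many uses, as needed for the components of a composition and for
    the values a minimization rejects. *)
Lemma common_use (n : nat) (Q : nat -> nat -> Prop) :
    (forall i m m', m <= m' -> Q i m -> Q i m') ->
    (forall i, i < n -> exists m, Q i m) ->
  exists m, forall i, i < n -> Q i m.
Proof.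
move=> mono; elim: n => [|n IHn] exQ; first by exists 0.
have [m Hm] := IHn (fun i lti => exQ i (ltnW lti)).
have [m' Hm'] := exQ n (ltnSn n).
exists (maxn m m') => i; rewrite ltnS leq_eqVlt => /predU1P [-> | /Hm].
  by apply: mono Hm'; apply: leq_maxr.
by apply: mono; apply: leq_maxl.
Qed.

(** Continuity: a halting computation queries its oracle only finitely often. *)
Lemma eval_use f n (c : code n) xs y : eval f c xs y ->
  exists m, forall g, agree m f g -> eval g c xs y.
Proof.
elim: c xs y => {n} [n|| n i || m n c IHc ds IHd | n c IHc d IHd | n c IHc]
  xs y /=; try by move=> ->; exists 0.
- by move=> ->; exists (thead xs).+1 => g; apply.
- move=> [ys Hys /IHc [m1 Hm1]].
  have [||m2 Hm2] := @common_use m (fun i k => forall lti : i < m,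
    forall g, agree k f g ->
      eval g (ds (Ordinal lti)) xs (tnth ys (Ordinal lti))).
  + by move=> i k k' lek H lti g /(agree_le lek); apply: H.
  + move=> i lti; have [k Hk] := IHd _ _ _ (Hys (Ordinal lti)).
    by exists k => lti'; rewrite (bool_irrelevance lti' lti).
  exists (maxn m1 m2) => g fg; exists ys => [[i lti]|].
    exact: Hm2 (agree_le (leq_maxr _ _) fg).
  exact: Hm1 (agree_le (leq_maxl _ _) fg).
- elim: (thead xs) y => [|k IHk] y /=; first exact: IHc.
  move=> [z /IHk [m1 Hm1] /IHd [m2 Hm2]].
  exists (maxn m1 m2) => g fg; exists z.
    exact: Hm1 (agree_le (leq_maxl _ _) fg).
  exact: Hm2 (agree_le (leq_maxr _ _) fg).
- move=> [/IHc [m1 Hm1] Ly].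
  have [||m2 Hm2] := @common_use y (fun z m => exists k,
    forall g, agree m f g -> eval g c [tuple of z :: xs] k.+1).
  + by move=> i m m' lem [k Hk]; exists k => g /(agree_le lem); apply: Hk.
  + by move=> z /Ly [k /IHc [m Hm]]; exists m, k.
  exists (maxn m1 m2) => g fg; split=> [|z /Hm2 [k Hk]].
    exact: Hm1 (agree_le (leq_maxl _ _) fg).
  by exists k; apply: Hk (agree_le (leq_maxr _ _) fg).
Qed.

(* Trees that do not encode a program of arity [n] decode to the junk value
   [Zero n]. *)
Fixpoint decode (t : GenTree.tree nat) (n : nat) : code n :=
  match t with
  | GenTree.Leaf 0 => match n with 1 => Succ | n => Zero n end
  | GenTree.Leaf 1 => match n with 1 => Oracle | n => Zero n end
  | GenTree.Leaf k.+2 => if insub k is Some i then Proj i else Zero n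
  | GenTree.Node 0 [:: c] => Mu (decode c n.+1)
  | GenTree.Node 1 [:: c; d] =>
      match n with 0 => Zero 0 | n'.+1 => Rec (decode c n') (decode d n'.+2) end
  | GenTree.Node m.+2 (c :: ts) =>
      Comp (decode c m)
        (fun i : 'I_m => nth (Zero n) [seq decode t n | t <- ts] i)
  | _ => Zero n
  end.

(** Gives a countable list of all programs; diagonalization needs no unique indices. *)
Lemma decode_surj n (c : code n) : exists t, decode t n = c.
Proof.
elim: c => {n} [n|| n i || m n c [t <-] ds IHd | n c [t <-] d [u <-]
  | n c [t <-]].
- by exists (GenTree.Node 0 [::]).
- by exists (GenTree.Leaf 0).
- by exists (GenTree.Leaf i.+2); rewrite /= valK.
- by exists (GenTree.Leaf 1).
- have [u Hu] := choice IHd.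
  exists (GenTree.Node m.+2 (t :: codom u)) => /=; congr Comp.
  apply/funext => i; rewrite -map_comp (nth_map i) ?size_enum_ord //=.
  by rewrite nth_ord_enum Hu.
- by exists (GenTree.Node 1 [:: t; u]).
- by exists (GenTree.Node 0 [:: t]).
Qed.

Definition program (i : nat) : code 1 :=
  if unpickle i is Some t then decode t 1 else Zero 1.

Lemma program_surj e : exists i, program i = e.
Proof.
by have [t <-] := decode_surj e; exists (pickle t); rewrite /program pickleK.
Qed.

(** * A perfect set of pairwise Turing incomparable functions *)

(* The condition [(P, n)] assigns to the node [a] the first [n] values of
   [P a]. *)
Definition cond := ((seq bool -> nat -> nat) * nat)%type.

Definition extends (p q : cond) :=
  p.2 <= q.2 /\ forall a, agree p.2 (p.1 a) (q.1 a).

Lemma extends_trans q p r : extends p q -> extends q r -> extends p r.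
Proof.
move=> [lepq pq] [leqr qr]; split; first exact: leq_trans leqr.
by move=> a; apply: agree_trans (pq a) (agree_le lepq (qr a)).
Qed.

Definition requirement := (seq bool * seq bool * nat)%type.

(** This is forcing: ranging over all extensions of the two finite strings makes the property
    persist under [extends]. *)
Definition meets (p : cond) (r : requirement) :=
  r.1.1 != r.1.2 -> forall f g, agree p.2 (p.1 r.1.1) f ->
    agree p.2 (p.1 r.1.2) g -> ~ functional (program r.2) f g.

Lemma meets_extends p q r : extends p q -> meets p r -> meets q r.
Proof.
by move=> [le pq] Hp neq f g qf qg;
  apply: Hp => //; apply: agree_trans (pq _) (agree_le le _).
Qed.

(** The Kleene-Post step. If no extension of the string at [a] makes the program halt on [n], the
    condition already suffices. Otherwise such a computation is preserved, and the string at [b] is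
    made to disagree with its output. *)
Lemma meet_requirement p r : exists2 q, extends p q & meets q r.
Proof.
case: p r => P n [[a b] i].
have [[f [y [Pf Hy]]] | noval] := pselect (exists f y,
    agree n (P a) f /\ eval f (program i) [tuple n] y); last first.
  by exists (P, n) => // _ f g Pf _ fg; apply: noval; exists f, (g n).
have [m Hm] := eval_use Hy.
(* [n] is the first argument at which the string at [b] is still undecided. *)
pose Pb x := if x == n then y.+1 else P b x.
pose Q c := if c == a then f else if c == b then Pb else P c.
have PQ c : agree n (P c) (Q c).
  move=> x ltx; rewrite /Q; case: eqP => [->|_]; first exact: Pf.
  by case: eqP => // ->; rewrite /Pb ltn_eqF.
(* This length fixes both the use [m] at [a] and the new value at [n]. *)
exists (Q, maxn m n.+1) => [|neq f' g /=].
  by split=> //=; rewrite leq_max leqnSn orbT.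
rewrite /Q eqxx eq_sym (negPf neq) eqxx => ff' Qg /(_ n) Hg.
have := eval_inj Hg (Hm f' (agree_le (leq_maxl _ _) ff')).
rewrite -Qg ?leq_maxr // /Pb eqxx => /eqP.
by rewrite eqn_leq ltnn.
Qed.

Lemma meet_requirements p (rs : seq requirement) :
  exists2 q, extends p q & forall r, r \in rs -> meets q r.
Proof.
elim: rs => [|r rs [q pq Hq]]; first by exists p.
have [q' qq' Hq'] := meet_requirement q r.
exists q' => [|r']; first exact: extends_trans qq'.
by rewrite inE => /predU1P [-> // | /Hq]; apply: meets_extends.
Qed.

Definition level_requirements (s : nat) : seq requirement :=
  [seq (ab, i) | ab <- [seq (val a, val b) | a <- enum {:s.-tuple bool},
                                             b <- enum {:s.-tuple bool}],
                 i <- iota 0 s].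

Lemma mem_level_requirements s (a b : seq bool) i :
  size a = s -> size b = s -> i < s -> (a, b, i) \in level_requirements s.
Proof.
move=> sa sb lti; apply: (allpairs_f pair); last by rewrite mem_iota.
have /= := allpairs_f (fun a b : s.-tuple bool => (val a, val b))
  (mem_enum predT (tcast sa (in_tuple a)))
  (mem_enum predT (tcast sb (in_tuple b))).
by rewrite !val_tcast; apply.
Qed.

(* Before level [s.+1], each node inherits the condition of its parent. *)
Definition split_nodes (s : nat) (p : cond) : cond :=
  (fun a => p.1 (take s a), p.2.+1).

Lemma incomparable_family : exists F : (nat -> bool) -> nat -> nat,
  forall alpha beta e, functional e (F alpha) (F beta) -> alpha = beta.
Proof.
have step_ex (sp : nat * cond) : exists q,
    extends (split_nodes sp.1 sp.2) q /\
    forall r, r \in level_requirements sp.1.+1 -> meets q r.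
  by have [q] := meet_requirements (split_nodes sp.1 sp.2)
    (level_requirements sp.1.+1); exists q.
have {step_ex} [step step_ext] := choice step_ex.
pose T := fix T s : cond :=
  if s is s'.+1 then step (s', T s') else ((fun _ _ => 0), 0).
have Text s : extends (split_nodes s (T s)) (T s.+1).
  by have [] := step_ext (s, T s).
(* The successor in [split_nodes] forces the strings to grow at every level. *)
have Tlen s : s <= (T s).2.
  by elim: s => // s IHs; have [+ _] := Text s; apply: leq_trans.
pose B alpha s := (T s).1 (mkseq alpha s).
have lenS s : (T s).2 <= (T s.+1).2.
  by have [/ltnW] := Text s.
have BS alpha s : agree (T s).2 (B alpha s) (B alpha s.+1).
  move=> x ltx; have [_ /(_ (mkseq alpha s.+1) x)] := Text s.
  rewrite /= /mkseq -map_take take_iota (minn_idPl (leqnSn s)).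
  by apply; apply: ltnW.
have Bext alpha s t : s <= t ->
    (T s).2 <= (T t).2 /\ agree (T s).2 (B alpha s) (B alpha t).
  move=> /subnK <-; elim: (t - s) => [//|k [le IHk]].
  split; first exact: leq_trans (lenS _).
  exact: agree_trans IHk (agree_le le (BS _ _)).
(* By [Tlen], the value at [x] is settled at level [x.+1]. *)
pose F alpha x := B alpha x.+1 x.
have BF alpha s : agree (T s).2 (B alpha s) (F alpha).
  move=> x ltx; rewrite /F; have [le|/ltnW le] := leqP s x.+1.
    by have [_ ->] := Bext alpha _ _ le.
  by have [_ ->] := Bext alpha _ _ le => //; apply: Tlen.
exists F => alpha beta e; have [i <-] := program_surj e => Hi.
apply/funext => x; apply/eqP/negP => /negP neq.
(* Level [s.+1] treats program [i], and its nodes are long enough to contain the position [x] where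
   the branches differ. *)
pose s := maxn i x.
have [_ /(_ (mkseq alpha s.+1, mkseq beta s.+1, i))] := step_ext (s, T s).
apply; last exact: Hi.
- by apply: mem_level_requirements; rewrite ?size_mkseq // ltnS leq_maxl.
- apply: contra neq => /eqP /(congr1 (nth true ^~ x)).
  by rewrite !nth_mkseq ?ltnS ?leq_maxr // => ->.
- exact: (BF alpha s.+1).
- exact: (BF beta s.+1).
Qed.

(** * The embedding *)

Definition turing_le (f g : nat -> nat) := exists e, functional e g f.

(** Lets Turing reducibility inherit its properties from Medvedev reducibility of singletons. *)
Lemma turing_leP f g :
  turing_le f g <-> medvedev_le [set f]%classic [set g]%classic.
Proof.
split=> [[e He]|/medvedev_leP [e He]].
  by apply/medvedev_leP; exists e => _ ->; exists f.
by have [_ ->] := He g erefl; exists e.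
Qed.

Lemma turing_le_refl f : turing_le f f.
Proof. exact/turing_leP/medvedev_le_refl. Qed.

Lemma turing_le_trans g f h : turing_le f g -> turing_le g h -> turing_le f h.
Proof.
by move=> /turing_leP fg /turing_leP gh; apply/turing_leP/(medvedev_le_trans fg).
Qed.

Lemma mass_sum_set1 f g : (mass_sum [set f] [set g] = [set oplus f g])%classic.
Proof.
by apply/seteqP; split=> [_ [_ [_ [-> -> ->]]] //|_ ->]; exists f, g.
Qed.

Lemma turing_le_oplusl f g : turing_le f (oplus f g).
Proof. by apply/turing_leP; rewrite -mass_sum_set1; apply: mass_sum_ub1. Qed.

Lemma turing_le_oplusr f g : turing_le g (oplus f g).
Proof. by apply/turing_leP; rewrite -mass_sum_set1; apply: mass_sum_ub2. Qed.

Lemma medvedev_le_subset (A B : mass_problem) :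
  (B `<=` A)%classic -> medvedev_le A B.
Proof.
by move=> BA; apply/medvedev_leP; exists Oracle => f Bf; exists f => //; apply: BA.
Qed.

Section Embedding.
Variables (T : Type) (F : T -> nat -> nat).

Definition one_or_two (I : set T) : mass_problem :=
  [set h | (exists2 a, I a & turing_le (F a) h) \/
           exists a b, [/\ a <> b, turing_le (F a) h & turing_le (F b) h]]%classic.

Lemma one_or_twoS (I J : set T) :
  (I `<=` J)%classic -> (one_or_two I `<=` one_or_two J)%classic.
Proof.
by move=> IJ h [[a Ia Fa]|two]; [left; exists a => //; apply: IJ | right].
Qed.

Lemma one_or_two_sum (I J : set T) :
  (mass_sum (one_or_two I) (one_or_two J) `<=` one_or_two (I `&` J))%classic.
Proof.
move=> _ [f [g [If Jg ->]]].
have up1 a : turing_le (F a) f -> turing_le (F a) (oplus f g).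
  by move=> H; apply: turing_le_trans H (turing_le_oplusl f g).
have up2 a : turing_le (F a) g -> turing_le (F a) (oplus f g).
  by move=> H; apply: turing_le_trans H (turing_le_oplusr f g).
case: If => [[a Ia Fa]|[a [b [ab Fa Fb]]]]; last first.
  by right; exists a, b; split; auto.
case: Jg => [[b Jb Fb]|[b [c [bc Fb Fc]]]]; last first.
  by right; exists b, c; split; auto.
have [eab|ab] := pselect (a = b); last by right; exists a, b; split; auto.
by left; exists a; auto; split; rewrite // eab.
Qed.

Lemma one_or_two_join (I J : set T) :
  degree (one_or_two (I `&` J)%classic) =
  (degree (one_or_two I) `|` degree (one_or_two J))%O.
Proof.
rewrite degree_join; apply/degree_eq; split.
  exact/medvedev_le_subset/one_or_two_sum.
by apply: mass_sum_lub; apply/medvedev_le_subset/one_or_twoS => a [].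
Qed.

Hypothesis F_incomparable : forall a b e, functional e (F a) (F b) -> a = b.

Lemma one_or_two_le (I J : set T) :
  (I `<=` J)%classic <->
  (degree (one_or_two J) <= degree (one_or_two I))%O.
Proof.
split=> [IJ|/degree_le/medvedev_leP [e He] a Ia].
  exact/degree_le/medvedev_le_subset/one_or_twoS.
have [|h Jh ha] := He (F a).
  by left; exists a => //; apply: turing_le_refl.
(* Since [F a] computes [h], it computes every member of the family that [h] computes. *)
have only_a b : turing_le (F b) h -> b = a.
  move=> Fb; have [|d Hd] := @turing_le_trans h (F b) (F a) Fb; first by exists e.
  by rewrite (F_incomparable Hd).
case: Jh => [[b Jb /only_a <- //]|[b [c [bc /only_a eb /only_a ec]]]].
by case: bc; rewrite eb ec.
Qed.

End Embedding.

Theorem theorem5p3 :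
  exists F : set (nat -> bool) -> medvedev,
    [/\ injective F,
        forall I J : set (nat -> bool),
          (I `<=` J)%classic <-> (F J <= F I)%O
      & forall I J : set (nat -> bool),
          F (I `&` J)%classic = (F I `|` F J)%O].
Proof.
have [F F_incomparable] := incomparable_family.
exists (fun I => degree (one_or_two F I)); split.
- by move=> I J eIJ; apply/seteqP; split;
    apply/(one_or_two_le F_incomparable); rewrite eIJ.
- exact: one_or_two_le.
- exact: one_or_two_join.
Qed.
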